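(* Let $\alpha>0$ and consider on the phase space $\mathbb{R}^{2n}$, with canonical coordinates $(q,p)=(q_1,\dots,q_n,p_1,\dots,p_n)$, the dynamical system $$\frac{dq_i}{dt}=G^i(q,p),\qquad \frac{dp_i}{dt}=F^i(q,p)\qquad (i=1,\dots,n).$$ If the right-hand sides satisfy, for all $i,j\in\{1,\dots,n\}$, the fractional Helmholtz conditions $$\mathbf{D}^{\alpha}_{p_j}G^i-\mathbf{D}^{\alpha}_{p_i}G^j=0,\qquad \mathbf{D}^{\alpha}_{q_i}G^j+\mathbf{D}^{\alpha}_{p_j}F^i=0,\qquad \mathbf{D}^{\alpha}_{q_j}F^i-\mathbf{D}^{\alpha}_{q_i}F^j=0,$$ then the system is a fractional Hamiltonian system, i.e. the fractional differential 1-form $\beta_\alpha=\sum_{i=1}^n\bigl(G^i(dp_i)^\alpha-F^i(dq_i)^\alpha\bigr)$ is closed: $d^\alpha\beta_\alpha=0$.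
   Context: Fractional derivative: for $\alpha>0$, $\mathbf{D}^{\alpha}_{x}$ is the Riemann–Liouville derivative with initial point $0$, $$\mathbf{D}^{\alpha}_{x}f(x)=\frac{1}{\Gamma(m-\alpha)}\frac{\partial^m}{\partial x^m}\int_0^x\frac{f(y)\,dy}{(x-y)^{\alpha-m+1}},$$ where $m$ is the smallest whole number $\ge\alpha$; for a function of several variables it acts on the indicated variable with the others fixed, and for integer $\alpha$ it is the ordinary partial derivative of order $\alpha$. The functions $G^i,F^i$ are such that the derivatives appearing exist. Fractional forms: a fractional differential 1-form of order $\alpha$ in coordinates $x_1,\dots,x_N$ is a formal expression $\sum_i A_i(x)(dx_i)^\alpha$, where the symbols $(dx_i)^\alpha$ are basis elements and the wedge product $(dx_j)^\alpha\wedge(dx_i)^\alpha$ is bilinear and skew-symmetric. The fractional exterior derivative is $d^\alpha=\sum_j (dx_j)^\alpha\mathbf{D}^\alpha_{x_j}$, acting on functions by $d^\alpha V=\sum_j(\mathbf{D}^\alpha_{x_j}V)(dx_j)^\alpha$ and on 1-forms by $d^\alpha\bigl(\sum_i A_i(dx_i)^\alpha\bigr)=\sum_{i,j}(\mathbf{D}^\alpha_{x_j}A_i)\,(dx_j)^\alpha\wedge(dx_i)^\alpha$. On the phase space the coordinates are $(q_1,\dots,q_n,p_1,\dots,p_n)$, so $d^\alpha=\sum_i\bigl((dq_i)^\alpha\mathbf{D}^\alpha_{q_i}+(dp_i)^\alpha\mathbf{D}^\alpha_{p_i}\bigr)$. The system $\dot q_i=G^i$, $\dot p_i=F^i$ is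 called a fractional Hamiltonian system (of order $\alpha$) if $\beta_\alpha=\sum_i\bigl(G^i(dp_i)^\alpha-F^i(dq_i)^\alpha\bigr)$ is closed, i.e. $d^\alpha\beta_\alpha=0$. *)

(* Defs.v *)
From mathcomp Require Import all_boot all_order all_algebra.
From mathcomp Require Import all_classical all_reals all_analysis.

Set Implicit Arguments.
Unset Strict Implicit.
Unset Printing Implicit Defensive.

Import Order.TTheory GRing.Theory Num.Theory.
Import numFieldNormedType.Exports.

Local Open Scope classical_set_scope.
Local Open Scope ring_scope.

(* Meaningful for 0 < s only. *)
Definition euler_gamma (R : realType) (s : R) : R :=
  \int[@lebesgue_measure R]_(t in `]0, +oo[) (t `^ (s - 1) * expR (- t)).

(* The derivatives of order < m exist near x and the one of order m exists
   at x. *)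
Fixpoint n_derivable (R : realType) (m : nat) (f : R -> R) (x : R) : Prop :=
  if m is k.+1 then
    (\forall t \near x, n_derivable k f t) /\ derivable (derive1n k f) x 1
  else True.

(* For 0 < alpha, the ceiling is the smallest whole number >= alpha. *)
Definition rl_order (R : realType) (alpha : R) : nat := `|Num.ceil alpha|%N.

Definition rl_integrand (R : realType) (alpha : R) (f : R -> R) (x y : R) : R :=
  f y / (x - y) `^ (alpha - (rl_order alpha)%:R + 1).

Definition rl_integral (R : realType) (alpha : R) (f : R -> R) (x : R) : R :=
  \int[@lebesgue_measure R]_(y in `[0, x]) rl_integrand alpha f x y.

(* Integer orders are set apart: there the formula would involve Gamma(0). *)
Definition rl_derive (R : realType) (alpha : R) (f : R -> R) (x : R) : R :=
  if alpha \is a Num.int then derive1n (rl_order alpha) f x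
  else (euler_gamma ((rl_order alpha)%:R - alpha))^-1 *
       derive1n (rl_order alpha) (rl_integral alpha f) x.

(* Existence of the derivative computed by [rl_derive]. When alpha is not an
   integer, the real power of x - y, for y between 0 and x, is defined for
   0 < x only, so that the derivative exists at positive points only. *)
Definition rl_derivable (R : realType) (alpha : R) (f : R -> R) (x : R) : Prop :=
  if alpha \is a Num.int then n_derivable (rl_order alpha) f x
  else [/\ 0 < x,
        \forall t \near x, (@lebesgue_measure R).-integrable `[0, t]
          (EFin \o rl_integrand alpha f t) &
        n_derivable (rl_order alpha) (rl_integral alpha f) x].

Definition set_coord (R : realType) (N : nat) (x : 'rV[R]_N) (j : 'I_N) (t : R) :
    'rV[R]_N :=
  \row_k (if k == j then t else x 0 k).

Definition rl_partial (R : realType) (N : nat) (alpha : R) (j : 'I_N)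
    (f : 'rV[R]_N -> R) (x : 'rV[R]_N) : R :=
  rl_derive alpha (fun t => f (set_coord x j t)) (x 0 j).

Definition rl_partial_exists (R : realType) (N : nat) (alpha : R) (j : 'I_N)
    (f : 'rV[R]_N -> R) (x : 'rV[R]_N) : Prop :=
  rl_derivable alpha (fun t => f (set_coord x j t)) (x 0 j).

(* A 1-form of order alpha is given at each point by its row of coefficients
   A_i on the basis (dx_i)^alpha, and a 2-form by a skew-symmetric matrix
   whose (i, j) entry, for i < j, is its coefficient on
   (dx_i)^alpha /\ (dx_j)^alpha. *)
Definition frac_1form (R : realType) (N : nat) := 'rV[R]_N -> 'rV[R]_N.
Definition frac_2form (R : realType) (N : nat) := 'rV[R]_N -> 'M[R]_N.

Definition frac_dx (R : realType) (N : nat) (i : 'I_N) : 'rV[R]_N :=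
  delta_mx 0 i.
Arguments frac_dx R {N} i.

Definition frac_wedge (R : realType) (N : nat) (a b : 'rV[R]_N) : 'M[R]_N :=
  a^T *m b - b^T *m a.

Definition frac_ext_derive (R : realType) (N : nat) (alpha : R)
    (A : frac_1form R N) : frac_2form R N :=
  fun x => \sum_(i < N) \sum_(j < N)
    rl_partial alpha j (fun y => A y 0 i) x
      *: frac_wedge (frac_dx R j) (frac_dx R i).

Definition frac_closed_on (R : realType) (N : nat) (alpha : R)
    (U : set 'rV[R]_N) (A : frac_1form R N) : Prop :=
  forall x, U x -> frac_ext_derive alpha A x = 0.

(* Phase space is 'rV[R]_(n + n), with coordinates (q_1..q_n, p_1..p_n). *)
Definition idx_q (n : nat) (i : 'I_n) : 'I_(n + n) := lshift n i.
Definition idx_p (n : nat) (i : 'I_n) : 'I_(n + n) := rshift n i.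

Definition frac_beta (R : realType) (n : nat)
    (G F : 'I_n -> 'rV[R]_(n + n) -> R) : frac_1form R (n + n) :=
  fun z => \sum_(i < n)
    (G i z *: frac_dx R (idx_p i) - F i z *: frac_dx R (idx_q i)).

(* The system dq_i/dt = G i (q, p), dp_i/dt = F i (q, p) on the region U. *)
Definition frac_hamiltonian_on (R : realType) (n : nat) (alpha : R)
    (U : set 'rV[R]_(n + n)) (G F : 'I_n -> 'rV[R]_(n + n) -> R) : Prop :=
  frac_closed_on alpha U (frac_beta G F).

(* Main.v *)
(* The (dx_j)^alpha /\ (dx_i)^alpha are skew-symmetric, so a 1-form A is closed
   as soon as its matrix of fractional partial derivatives D_j A_i is
   symmetric. For beta_alpha, whose coefficients are -F^i on (dq_i)^alpha and
   G^i on (dp_i)^alpha, the blocks of this symmetry are exactly the Helmholtz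
   conditions, once D_j (- F^i) = - D_j F^i is known. *)
Require Import Defs.
From mathcomp Require Import all_boot all_order all_algebra.
From mathcomp Require Import all_classical all_reals all_analysis.

Import Order.TTheory GRing.Theory Num.Theory.
Import numFieldNormedType.Exports.

Local Open Scope classical_set_scope.
Local Open Scope ring_scope.

Lemma derive1nN (R : realType) (m : nat) (f : R -> R) (x : R) :
  n_derivable m f x ->
  derive1n m (fun t => - f t) x = - derive1n m f x.
Proof.
elim: m x => [//|m IHm] x /= [nf df].
rewrite !derive1E -deriveN//.
(* The derivative at [x] depends only on values near [x], and [nf] makes the induction hypothesis
   available on a whole neighbourhood. *)
apply: near_eq_derive.
by near=> t; apply: IHm; near: t.
Unshelve. all: by end_near. Qed.

(* When the positive and negative parts of f both have infinite integral, both
   sides are 0, since [+oo - +oo = -oo] and [fine -oo = 0]. *)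
Lemma RintegralN (d : measure_display) (T : measurableType d) (R : realType)
    (mu : {measure set T -> \bar R}) (D : set T) (f : T -> R) :
  \int[mu]_(x in D) (- f x) = - \int[mu]_(x in D) f x.
Proof.
rewrite /Rintegral [in LHS]integralE [in RHS]integralE.
have -> : (fun x => (- f x)%:E) = (\- (fun x => (f x)%:E))%E by [].
rewrite funeposN funenegN.
set a := integral _ _ _; set b := integral _ _ _.
have : (0 <= a)%E by exact: integral_ge0.
have : (0 <= b)%E by exact: integral_ge0.
case: a => [a| |]; case: b => [b| |] //= _ _; rewrite ?oppr0 //.
by rewrite opprB.
Qed.

Lemma rl_integralN (R : realType) (alpha : R) (f : R -> R) :
  rl_integral alpha (fun t => - f t) = (fun t => - rl_integral alpha f t).
Proof.
apply/funext => x; rewrite /rl_integral -RintegralN.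
by apply: eq_Rintegral => y _; rewrite /rl_integrand mulNr.
Qed.

(** The sign passes through the integral by linearity, then through the outer derivatives, whose
    existence is assumed; for integer [alpha] only the second move occurs. *)
Lemma rl_partialN (R : realType) (N : nat) (alpha : R) (j : 'I_N)
    (f : 'rV[R]_N -> R) (x : 'rV[R]_N) :
  rl_partial_exists alpha j f x ->
  rl_partial alpha j (fun y => - f y) x = - rl_partial alpha j f x.
Proof.
rewrite /rl_partial_exists /rl_partial /rl_derivable /rl_derive.
case: ifP => _; first exact: derive1nN.
by move=> [_ _ df]; rewrite rl_integralN derive1nN// mulrN.
Qed.

Lemma frac_ext_derive_eq0 (R : realType) (N : nat) (alpha : R)
    (A : frac_1form R N) (x : 'rV[R]_N) :
  (forall i j, rl_partial alpha j (fun y => A y 0 i) x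
             = rl_partial alpha i (fun y => A y 0 j) x) ->
  frac_ext_derive alpha A x = 0.
Proof.
move=> symA; rewrite /frac_ext_derive /frac_wedge.
under eq_bigr do (under eq_bigr do rewrite scalerBr; rewrite sumrB).
(* The wedge has been split into its two tensor products; swapping the roles of the indices in one
   double sum matches it with the other, up to [symA]. *)
rewrite sumrB exchange_big /=; apply/eqP; rewrite subr_eq0; apply/eqP.
by apply: eq_bigr => i _; apply: eq_bigr => j _; rewrite symA.
Qed.

Lemma frac_beta_q (R : realType) (n : nat) (G F : 'I_n -> 'rV[R]_(n + n) -> R)
    (k : 'I_n) (z : 'rV[R]_(n + n)) : frac_beta G F z 0 (idx_q k) = - F k z.
Proof.
rewrite summxE (bigD1 k)//= big1 => [|i ik];
  rewrite !mxE !eqxx eq_lrshift ?eq_lshift ?eqxx /=.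
  by rewrite mulr0 mulr1 add0r addr0.
by rewrite eq_sym (negbTE ik) !mulr0 subr0.
Qed.

Lemma frac_beta_p (R : realType) (n : nat) (G F : 'I_n -> 'rV[R]_(n + n) -> R)
    (k : 'I_n) (z : 'rV[R]_(n + n)) : frac_beta G F z 0 (idx_p k) = G k z.
Proof.
rewrite summxE (bigD1 k)//= big1 => [|i ik];
  rewrite !mxE !eqxx eq_rlshift ?eq_rshift ?eqxx /=.
  by rewrite mulr0 mulr1 subr0 addr0.
by rewrite eq_sym (negbTE ik) !mulr0 subr0.
Qed.

Theorem proposition6 (R : realType) (n : nat) (alpha : R)
    (U : set 'rV[R]_(n + n)) (G F : 'I_n -> 'rV[R]_(n + n) -> R)
    (alpha_gt0 : 0 < alpha)
    (derivG : forall (i : 'I_n) (k : 'I_(n + n)) (z : 'rV[R]_(n + n)), U z ->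
       rl_partial_exists alpha k (G i) z)
    (derivF : forall (i : 'I_n) (k : 'I_(n + n)) (z : 'rV[R]_(n + n)), U z ->
       rl_partial_exists alpha k (F i) z)
    (helmholtz_GG : forall (i j : 'I_n) (z : 'rV[R]_(n + n)), U z ->
       rl_partial alpha (idx_p j) (G i) z
         - rl_partial alpha (idx_p i) (G j) z = 0)
    (helmholtz_GF : forall (i j : 'I_n) (z : 'rV[R]_(n + n)), U z ->
       rl_partial alpha (idx_q i) (G j) z
         + rl_partial alpha (idx_p j) (F i) z = 0)
    (helmholtz_FF : forall (i j : 'I_n) (z : 'rV[R]_(n + n)), U z ->
       rl_partial alpha (idx_q j) (F i) z
         - rl_partial alpha (idx_q i) (F j) z = 0) :
  frac_hamiltonian_on alpha U G F.
Proof.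
have qN k i z : U z ->
    rl_partial alpha k (fun y => frac_beta G F y 0 (idx_q i)) z
    = - rl_partial alpha k (F i) z.
  move=> Uz; rewrite -rl_partialN; last exact: derivF.
  by congr rl_partial; apply/funext => y; rewrite frac_beta_q.
have pE k i z : rl_partial alpha k (fun y => frac_beta G F y 0 (idx_p i)) z
    = rl_partial alpha k (G i) z.
  by congr rl_partial; apply/funext => y; rewrite frac_beta_p.
move=> z Uz; apply: frac_ext_derive_eq0 => a b.
(* Blocks in the order qq, qp, pq, pp. The mixed Helmholtz condition serves both off-diagonal
   blocks, with [i] and [j] exchanged in the second. *)
case: (split_ordP a) => i ->; case: (split_ordP b) => j ->;
  rewrite -?/(idx_q _) -?/(idx_p _) ?(qN _ _ _ Uz) ?pE.
- by congr (- _); apply/subr0_eq/helmholtz_FF.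
- by apply/esym/eqP; rewrite -addr_eq0 helmholtz_GF.
- by apply/eqP; rewrite -addr_eq0 helmholtz_GF.
- exact/subr0_eq/helmholtz_GG.
Qed.
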